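(* Let $\mathcal{T}=(a,b,c)$ be a parity-class triple, put $\mathcal{R}=\mathrm{rad}(abc)$, let $f_2=v_2(N_{E_{\mathcal{T}}})$, and define $\kappa_2=4$ if $1\le v_2(c)\le3$ and $\kappa_2=-8$ if $v_2(c)\ge4$. Then $$\log|\Delta_{\min}(E_{\mathcal{T}})|=2\delta_{\mathrm{tot}}(\mathcal{T})+2\log\mathcal{R}+\kappa_2\log2,\qquad \log N_{E_{\mathcal{T}}}=\log\mathcal{R}+(f_2-1)\log2,$$ so that $$\mathrm{Szp}(E_{\mathcal{T}})=\frac{2\delta_{\mathrm{tot}}(\mathcal{T})+2\log\mathcal{R}+\kappa_2\log2}{\log\mathcal{R}+(f_2-1)\log2}.$$ If $\varepsilon>0$ and $E_\varepsilon(\mathcal{T})\ge0$, then $$\delta_{\mathrm{tot}}(\mathcal{T})\ge\log(ab)+\varepsilon\log\mathcal{R}$$ and therefore $$\mathrm{Szp}(E_{\mathcal{T}})\ \ge\ \frac{2(1+\varepsilon)\log\mathcal{R}+2\log(ab)+\kappa_2\log2}{\log\mathcal{R}+(f_2-1)\log2}.$$ Along a sequence of distinct parity-class triples with $E_\varepsilon(\mathcal{T})\ge0$ and $\mathcal{R}=\mathrm{rad}(abc)\to\infty$, this gives $$\mathrm{Szp}(E_{\mathcal{T}})\ \ge\ 2+2\varepsilon+O\left(\frac1{\log\mathcal{R}}\right)$$ with an absolute implied constant.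
   Context: A parity-class triple is a triple $\mathcal{T}=(a,b,c)$ of pairwise coprime positive integers with $a+b=c$, $a$ and $b$ odd, $c$ even. $\mathrm{rad}(n)$ is the product of the distinct primes dividing $n$, $v_p$ the $p$-adic valuation. The radical excess is the real number $E_\varepsilon(\mathcal{T})=\log c-(1+\varepsilon)\log\mathrm{rad}(abc)$ (not to be confused with the curve $E_{\mathcal{T}}$). The total defect is $\delta_{\mathrm{tot}}(\mathcal{T})=\log\bigl(abc/\mathrm{rad}(abc)\bigr)$. The oriented parity Frey curve $E_{\mathcal{T}}$ over $\mathbb{Q}$ is $y^2=x(x-\alpha)(x+\beta)$, where: if $4\mid c$, $\alpha$ is the unique member of $\{a,b\}$ with $\alpha\equiv1\pmod4$ and $\beta$ is the other member; if $4\nmid c$, $(\alpha,\beta)=(a,b)$. For an elliptic curve $E/\mathbb{Q}$, $\Delta_{\min}(E)$ is its (global) minimal discriminant, $N_E$ its conductor, and, when $N_E>1$, the Szpiro quotient is $\mathrm{Szp}(E)=\log|\Delta_{\min}(E)|/\log N_E$. *)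

(* Defs.v *)
From HB Require Import structures.
From mathcomp Require Import all_boot all_order all_algebra all_fingroup all_field.
From mathcomp Require Import finmap.
From mathcomp Require Import boolp classical_sets cardinality reals exp.

Set Implicit Arguments.
Unset Strict Implicit.
Unset Printing Implicit Defensive.

Import Order.TTheory GRing.Theory Num.Theory.
Local Open Scope ring_scope.

(** * Weierstrass equations
    y^2 + a1 x y + a3 y = x^3 + a2 x^2 + a4 x + a6 *)

Record weierstrass (K : Type) :=
  Weierstrass { a1 : K; a2 : K; a3 : K; a4 : K; a6 : K }.

Definition map_weierstrass (K K' : Type) (f : K -> K') (W : weierstrass K) :=
  Weierstrass (f (a1 W)) (f (a2 W)) (f (a3 W)) (f (a4 W)) (f (a6 W)).

Section Invariants.
Variables (K : comNzRingType) (W : weierstrass K).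

Definition b2 : K := a1 W ^+ 2 + 4 * a2 W.
Definition b4 : K := 2 * a4 W + a1 W * a3 W.
Definition b6 : K := a3 W ^+ 2 + 4 * a6 W.
Definition b8 : K :=
  a1 W ^+ 2 * a6 W + 4 * a2 W * a6 W - a1 W * a3 W * a4 W
  + a2 W * a3 W ^+ 2 - a4 W ^+ 2.
Definition discriminant : K :=
  - b2 ^+ 2 * b8 - 8 * b4 ^+ 3 - 27 * b6 ^+ 2 + 9 * b2 * b4 * b6.

Definition on_curve (x y : K) : Prop :=
  y ^+ 2 + a1 W * x * y + a3 W * y
  = x ^+ 3 + a2 W * x ^+ 2 + a4 W * x + a6 W.

Definition singular_at (x y : K) : Prop :=
  [/\ on_curve x y,
      a1 W * y = 3 * x ^+ 2 + 2 * a2 W * x + a4 W &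
      2 * y + a1 W * x + a3 W = 0].

(** The tangent slopes at a singular point (x, y) are the roots of
    t^2 + a1 t - (a2 + 3 x); a node is a singular point at which they are
    distinct.  Over a perfect field the singular point is always rational, so
    it is enough to look for it in [K]. *)
Definition has_node : Prop :=
  exists x y, singular_at x y /\ a1 W ^+ 2 + 4 * (a2 W + 3 * x) != 0.

End Invariants.

(** [W'] is obtained from [W] by x = u^2 x' + r, y = u^3 y' + u^2 s x' + t. *)
Definition isomorphic (K : fieldType) (W W' : weierstrass K) : Prop :=
  exists u r s t : K,
    u != 0 /\
    [/\ u * a1 W' = a1 W + 2 * s,
        u ^+ 2 * a2 W' = a2 W - s * a1 W + 3 * r - s ^+ 2,
        u ^+ 3 * a3 W' = a3 W + r * a1 W + 2 * t,
        u ^+ 4 * a4 W' = a4 W - s * a3 W + 2 * r * a2 W - (t + r * s) * a1 W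
                         + 3 * r ^+ 2 - 2 * s * t &
        u ^+ 6 * a6 W' = a6 W + r * a4 W + r ^+ 2 * a2 W + r ^+ 3
                         - t * a3 W - t ^+ 2 - r * t * a1 W].

(** * Minimal models, minimal discriminant and reduction types over Q *)

Definition padic_val (p : nat) (x : rat) : int :=
  (logn p `|numq x|%N)%:Z - (logn p `|denq x|%N)%:Z.

Definition padic_integer (p : nat) (x : rat) : Prop := ~~ (p %| `|denq x|)%N.

Definition padic_integral (p : nat) (W : weierstrass rat) : Prop :=
  [/\ padic_integer p (a1 W), padic_integer p (a2 W), padic_integer p (a3 W),
      padic_integer p (a4 W) & padic_integer p (a6 W)].

Definition minimal_model_at (p : nat) (E W : weierstrass rat) : Prop :=
  [/\ isomorphic E W, padic_integral p W &
      forall W', isomorphic E W' -> padic_integral p W' ->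
        padic_val p (discriminant W) <= padic_val p (discriminant W')].

Definition global_minimal_model (E : weierstrass rat) (W : weierstrass int) :=
  forall p, prime p -> minimal_model_at p E (map_weierstrass intr W).

(** Global minimal models exist over Q and have the same discriminant, so the
    default value 0 is never used for an elliptic curve. *)
Definition minimal_discriminant (E : weierstrass rat) : int :=
  xget 0 [set d | exists2 W, global_minimal_model E W & d = discriminant W]%classic.

Definition good_reduction (p : nat) (E : weierstrass rat) : Prop :=
  exists2 W, minimal_model_at p E W & padic_val p (discriminant W) = 0.

(** On p-integral rationals, [ratr : rat -> 'F_p] is reduction modulo p. *)
Definition multiplicative_reduction (p : nat) (E : weierstrass rat) : Prop :=
  exists2 W, minimal_model_at p E W &
    has_node (map_weierstrass (ratr : rat -> 'F_p) W).

(** * Points and torsion *)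

(** [None] is the point at infinity. *)
Definition point (K : Type) : Type := option (K * K).

Section Points.
Variables (K : fieldType) (W : weierstrass K).

Definition is_point (P : option (K * K)) : Prop :=
  if P is Some (x, y) then on_curve W x y else True.

Definition add_point (P Q : option (K * K)) : option (K * K) :=
  match P, Q with
  | None, _ => Q
  | _, None => P
  | Some (x1, y1), Some (x2, y2) =>
    if (x1 == x2) && (y1 + y2 + a1 W * x2 + a3 W == 0) then None else
    let slope :=
      if x1 == x2 then
        (3 * x1 ^+ 2 + 2 * a2 W * x1 + a4 W - a1 W * y1)
        / (2 * y1 + a1 W * x1 + a3 W)
      else (y2 - y1) / (x2 - x1) in
    let x3 := slope ^+ 2 + a1 W * slope - a2 W - x1 - x2 in
    Some (x3, - (slope + a1 W) * x3 - (y1 - slope * x1) - a3 W)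
  end.

Definition torsion (l : nat) : set (option (K * K)) :=
  [set P | is_point P /\ iter l (add_point P) None = None]%classic.

End Points.

Definition map_point (K K' : Type) (f : K -> K') (P : point K) : point K' :=
  omap (fun xy => (f xy.1, f xy.2)) P.

(** * The conductor

    N = prod_p p^f_p, where f_p is 0 for good reduction, 1 for multiplicative
    reduction and 2 + delta_p for additive reduction.  The wild part delta_p
    is the Swan exponent
      delta_p = sum_(i >= 1) #G_i / #G_0 * dim_{F_l} (E[l] / E[l]^{G_i}),
    with l a prime different from p (the value does not depend on l), and G_i
    the ramification groups, in lower numbering, of the extension of Q_p
    generated by E[l] (Silverman, Advanced Topics, IV.10).

    The local extension is presented as the completion of L = Q(E[l]) at a
    place w above p: a lower ramification group of the completion, of index
    i >= 0, restricts isomorphically onto the group of those automorphisms of L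
    that act trivially on O_w modulo the (i+1)-st power of its maximal ideal. *)

Section Ramification.
Variables (L : splittingFieldType rat) (w : L -> int).

(** [w] is meaningful on nonzero elements only; the valuation of 0 is
    infinite. *)
Definition val_ge (k : int) (x : L) : Prop := x = 0 \/ k <= w x.

Definition normalized_valuation_above (p : nat) : Prop :=
  [/\ forall x y, x != 0 -> y != 0 -> w (x * y) = w x + w y,
      forall k x y, val_ge k x -> val_ge k y -> val_ge k (x + y),
      exists2 x, x != 0 & w x = 1 &
      0 < w p%:R].

Definition ramification_group (i : nat) : {set gal_of {:L}} :=
  [set s in 'Gal({:L} / 1)%g |
    `[< forall x : L, val_ge 0 x -> val_ge (i.+1)%:Z (s x - x) >]].

End Ramification.

Section DivisionField.
Variables (E : weierstrass rat) (l : nat).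
Variables (L : splittingFieldType rat).

Definition torsion_over : set (option (L * L)) :=
  torsion (map_weierstrass ratr E) l.

(** [L] is, via [iota], the subfield of the algebraic closure of Q generated
    by the coordinates of the l-torsion points. *)
Definition is_division_field (iota : {rmorphism L -> algC}) : Prop :=
  (forall P, torsion (map_weierstrass (ratr : rat -> algC) E) l P ->
     exists Q : point L, P = map_point iota Q) /\
  (forall F : {subfield L},
     (forall x y, torsion_over (Some (x, y)) -> x \in F /\ y \in F) ->
     F = {:L}%VS :> {vspace L}).

Definition fixed_torsion (G : {set gal_of {:L}}) : set (option (L * L)) :=
  [set P | torsion_over P /\ forall s, s \in G -> map_point s P = P]%classic.

(** dim_{F_l} (E[l] / E[l]^G), for l prime: a finite F_l-vector space of
    cardinal l^d has dimension d. *)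
Definition fixed_codim (G : {set gal_of {:L}}) : nat :=
  (logn l #|` fset_set torsion_over| - logn l #|` fset_set (fixed_torsion G)|)%N.

End DivisionField.

Definition auxiliary_prime (p : nat) : nat := if p == 2%N then 3%N else 2%N.

(** The ramification groups decrease with i, so once the M-th is trivial all
    later terms of the sum defining delta_p vanish. *)
Definition is_wild_exponent (E : weierstrass rat) (p n : nat) : Prop :=
  let l := auxiliary_prime p in
  exists (L : splittingFieldType rat) (iota : {rmorphism L -> algC})
         (w : L -> int) (M : nat),
    [/\ is_division_field E l iota,
        normalized_valuation_above w p,
        ramification_group w M \subset [1 gal_of {:L}]%g &
        (\sum_(1 <= i < M)
           #|ramification_group w i| * fixed_codim E l (ramification_group w i)
         = n * #|ramification_group w 0|)%N].

(** That delta_p exists, is an integer, and is independent of the choices is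
    classical. *)
Definition wild_exponent (E : weierstrass rat) (p : nat) : nat :=
  xget 0%N [set n | is_wild_exponent E p n]%classic.

Definition conductor_exponent (E : weierstrass rat) (p : nat) : nat :=
  if `[< good_reduction p E >] then 0%N
  else if `[< multiplicative_reduction p E >] then 1%N
  else (2 + wild_exponent E p)%N.

(** The primes of bad reduction are those dividing the minimal discriminant. *)
Definition conductor (E : weierstrass rat) : nat :=
  (\prod_(p <- primes `|minimal_discriminant E|) p ^ conductor_exponent E p)%N.

Definition szpiro (R : realType) (E : weierstrass rat) : R :=
  ln (`|minimal_discriminant E|%N%:R) / ln ((conductor E)%:R).

(** * Parity-class triples *)

Record triple := Triple { ta : nat; tb : nat; tc : nat }.

Definition parity_class (T : triple) : Prop :=
  [/\ [/\ (0 < ta T)%N, (0 < tb T)%N & (0 < tc T)%N],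
      [/\ coprime (ta T) (tb T), coprime (ta T) (tc T) & coprime (tb T) (tc T)],
      (ta T + tb T = tc T)%N &
      [/\ odd (ta T), odd (tb T) & ~~ odd (tc T)]].

Definition abc (T : triple) : nat := (ta T * tb T * tc T)%N.

Definition radical (n : nat) : nat := (\prod_(p <- primes n) p)%N.

Definition radical_excess (R : realType) (eps : R) (T : triple) : R :=
  ln (tc T)%:R - (1 + eps) * ln (radical (abc T))%:R.

Definition total_defect (R : realType) (T : triple) : R :=
  ln ((abc T)%:R / (radical (abc T))%:R).

(** y^2 = x (x - alpha) (x + beta) *)
Definition frey_equation (alpha beta : rat) : weierstrass rat :=
  Weierstrass 0 (beta - alpha) 0 (- (alpha * beta)) 0.

Definition frey (T : triple) : weierstrass rat :=
  if (4 %| tc T)%N && (ta T %% 4 != 1)%N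
  then frey_equation (tb T)%:R (ta T)%:R
  else frey_equation (ta T)%:R (tb T)%:R.

Definition kappa2 (T : triple) : int :=
  if (logn 2 (tc T) <= 3)%N then 4 else - 8%:Z.

(* Main.v *)
Require Import Defs.
From mathcomp Require Import all_boot all_order all_algebra.
From mathcomp Require Import all_fingroup all_solvable all_field.
From mathcomp Require Import finmap.
From mathcomp Require Import boolp classical_sets cardinality reals exp.
From mathcomp Require Import zify ring lra.

(** Write [E] for the curve y^2 = x (x - al) (x + be), where al + be = c and
    {al, be} = {a, b}.

    Discriminant.  The given equation has discriminant 16 (abc)^2 and
    c4 = 16 (al^2 + al be + be^2), and a prime dividing abc = al be (al + be)
    cannot divide al^2 + al be + be^2 because al and be are coprime.  A change
    of variables divides the discriminant by a twelfth power and c4 by the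
    fourth power of the same number, so an integral equation is minimal at p as
    soon as p^12 does not divide its discriminant or p does not divide its c4
    ([minimal_model_criterion]).  Hence the given equation is minimal at every
    odd prime, and at 2 when v_2(c) <= 3, since 16 (abc)^2 then has 2-adic
    valuation 4 + 2 v_2(c) < 12.  When 16 divides c, the normalisation
    al = 1 mod 4 lets one replace it by an integral equation whose discriminant
    is smaller by 2^12 and whose c4 is al^2 + al be + be^2, and this one is
    minimal everywhere.  The two cases give the two values of kappa_2.

    Conductor.  At an odd prime dividing abc exactly two of the roots 0, al,
    -be of the cubic collide, so the reduction is multiplicative and the
    conductor exponent is 1 ([frey_odd_exponent]).  Therefore N is
    2^f_2 times the product of the odd primes dividing abc, while rad(abc) is
    2 times that product; this is the formula for log N ([frey_conductor]).

    Defect.  The total defect is log(ab) + log c - log R, so its lower bound is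
    the inequality log c >= (1 + eps) log R rewritten.

    Asymptotics.  Since ab >= c / 2 and log c >= (1 + eps) log R, the numerator
    of the Szpiro quotient is at least 4 (1 + eps) log R - 10 log 2, twice the
    main term that is needed.  So 2 + 2 eps is a lower bound for the quotient,
    without any error term, as soon as R exceeds a bound depending only on the
    size of f_2 ([szpiro_ge_large]).

    What remains is an absolute bound for f_2, that is for the wild part of the
    conductor at 2, sum_(i >= 1) #G_i / #G_0 * dim (E[3] / E[3]^{G_i}).  Each
    term is at most 2, so it is enough to bound the last i with G_i nontrivial.
    Let L = Q(E[3]), d = [L : Q], and let w be a valuation of L above 2.
    Take s in G_i different from 1 and an integral x moved by s, and put
    y = s x - x.  All the conjugates s^k y agree with y modulo valuation
    w(y) + i, while y + s y + ... + s^(d-1) y = s^d x - x = 0; so d y has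
    valuation at least w(y) + i, and i <= w(d) ([ram_index_le]).  Now w(d) is
    v_2(d) times the ramification index w(2), which is at most d because the
    powers of a uniformizer with exponent below w(2) are linearly independent
    over Q ([val_p_le_dim]).  Finally d = #Gal(L / Q) is bounded because the Galois
    group acts faithfully on the points of order three, and there are at most
    eight of them: their abscissas are roots of the quartic 3-division
    polynomial ([division_field_dim]). *)

Set Implicit Arguments.
Unset Strict Implicit.
Unset Printing Implicit Defensive.

Import Order.TTheory GRing.Theory Num.Theory.
Local Open Scope ring_scope.

(** The valuations of the terms of a polynomial in a uniformizer are told apart
    by their residues modulo the ramification index. *)
Lemma residue_neq (e k l : int) (j : nat) :
  (0 < j)%N -> j%:Z < e -> e * k + j%:Z <> e * l.
Proof.
move=> j0 je E.
have [lk|kl] := leP l k.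
  have : e * l <= e * k by apply: ler_wpM2l => //; lia.
  by lia.
have : e * (k + 1) <= e * l by apply: ler_wpM2l; lia.
by rewrite mulrDr mulr1; lia.
Qed.

(** * Valuations of a Galois number field *)

Section Valuation.
Variables (L : splittingFieldType rat) (w : L -> int) (p : nat).
Hypotheses (p_prime : prime p) (w_above : normalized_valuation_above w p).

Lemma valM x y : x != 0 -> y != 0 -> w (x * y) = w x + w y.
Proof. by case: w_above => + _ _ _; apply. Qed.

Lemma val_geD k x y : val_ge w k x -> val_ge w k y -> val_ge w k (x + y).
Proof. by case: w_above => _ + _ _; apply. Qed.

Lemma val_ge0 k : val_ge w k 0. Proof. by left. Qed.

Lemma val_geP k x : x != 0 -> val_ge w k x <-> k <= w x.
Proof. by move=> /eqP x0; split=> [[]//|]; right. Qed.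

Lemma val_ge_refl x : val_ge w (w x) x. Proof. by right. Qed.

Lemma val_ge_trans k l x : l <= k -> val_ge w k x -> val_ge w l x.
Proof. by move=> lk [->|kx]; [left|right; apply: le_trans kx]. Qed.

Lemma val_geM k l x y : val_ge w k x -> val_ge w l y -> val_ge w (k + l) (x * y).
Proof.
move=> [->|kx]; first by rewrite mul0r; left.
move=> [->|ly]; first by rewrite mulr0; left.
have [->|x0] := eqVneq x 0; first by rewrite mul0r; left.
have [->|y0] := eqVneq y 0; first by rewrite mulr0; left.
by right; rewrite valM // lerD.
Qed.

Lemma val1 : w 1 = 0.
Proof.
have := valM (oner_neq0 L) (oner_neq0 L); rewrite mulr1; move: (w 1) => a; lia.
Qed.

Lemma valN1 : w (-1) = 0.
Proof.
have n0 : (-1 : L) != 0 by rewrite oppr_eq0 oner_neq0.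
have := valM n0 n0; rewrite mulrNN mulr1 val1; move: (w _) => a; lia.
Qed.

Lemma val_geN k x : val_ge w k x -> val_ge w k (- x).
Proof.
move=> kx; rewrite -mulN1r -[k]add0r; apply: val_geM => //.
by right; rewrite valN1.
Qed.

Lemma val_geB k x y : val_ge w k x -> val_ge w k y -> val_ge w k (x - y).
Proof. by move=> kx /val_geN; apply: val_geD. Qed.

Lemma val_ge_sum (I : Type) (r : seq I) (F : I -> L) k :
  (forall i, val_ge w k (F i)) -> val_ge w k (\sum_(i <- r) F i).
Proof.
move=> kF; elim/big_ind: _ => //; [exact: val_ge0 | by move=> x y; apply: val_geD].
Qed.

Lemma valV x : x != 0 -> w x^-1 = - w x.
Proof.
move=> x0; have := valM x0 (invr_neq0 x0); rewrite divff // val1.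
by move: (w _) (w _) => a b; lia.
Qed.

Lemma valX x n : x != 0 -> w (x ^+ n) = w x *+ n.
Proof.
move=> x0; elim: n => [|n IHn]; first by rewrite expr0 val1 mulr0n.
by rewrite exprS valM ?expf_neq0 // IHn mulrS.
Qed.

Lemma valD_neq x y : x != 0 -> y != 0 -> w x != w y ->
  x + y != 0 /\ (w (x + y) = w x \/ w (x + y) = w y).
Proof.
wlog xy : x y / w x < w y => [IH|] x0 y0 wxy.
  case: (ltgtP (w x) (w y)) => [lt|gt|eq]; first exact: IH.
    by rewrite addrC; have [] // := IH _ _ gt y0 x0; rewrite 1?eq_sym //; tauto.
  by rewrite eq eqxx in wxy.
have s0 : x + y != 0.
  apply/eqP => /eqP; rewrite addr_eq0 => /eqP xNy.
  have : val_ge w (w y) x by rewrite xNy; apply/val_geN/val_ge_refl.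
  by rewrite val_geP // leNgt xy.
split=> //; left; apply/eqP; rewrite eq_le; apply/andP; split.
  rewrite leNgt; apply/negP => lt.
  pose m := Num.min (w (x + y)) (w y).
  have : val_ge w m x.
    rewrite -[x](addrK y); apply: val_geB.
      by apply: val_ge_trans (val_ge_refl _); rewrite ge_min lexx.
    by apply: val_ge_trans (val_ge_refl _); rewrite ge_min lexx orbT.
  by rewrite val_geP // leNgt lt_min lt xy.
rewrite -val_geP //; apply: val_geD; first exact: val_ge_refl.
by apply: val_ge_trans (val_ge_refl _); apply: ltW.
Qed.

Lemma natL_neq0 n : (0 < n)%N -> n%:R != 0 :> L.
Proof.
move=> n0; rewrite -[n%:R]scaler_nat scaler_eq0 oner_eq0 orbF.
by rewrite pnatr_eq0 -lt0n.
Qed.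

Lemma val_ge_nat n : val_ge w 0 n%:R.
Proof.
elim: n => [|n IHn]; first exact: val_ge0.
by rewrite mulrS; apply: val_geD => //; right; rewrite val1.
Qed.

Lemma val_p_gt0 : 0 < w p%:R. Proof. by case: w_above. Qed.

Lemma val_coprime n : (0 < n)%N -> coprime p n -> w n%:R = 0.
Proof.
move=> n0 co; apply/eqP; rewrite eq_le; apply/andP; split; last first.
  by have := val_ge_nat n; rewrite val_geP // natL_neq0.
rewrite leNgt; apply/negP => wn.
have [] := egcdnP n (prime_gt0 p_prime) => u v uv _.
have : val_ge w 1 (u%:R * p%:R - v%:R * n%:R).
  rewrite -[1]add0r; apply: val_geB; apply: val_geM; try exact: val_ge_nat.
    by right; rewrite -gtz0_ge1 val_p_gt0.
  by right; rewrite -gtz0_ge1.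
have := uv; rewrite (eqP co) => /(congr1 (fun k => k%:R : L)).
rewrite natrD !natrM => ->; rewrite addrAC subrr add0r.
by rewrite val_geP ?oner_neq0 // val1.
Qed.

Lemma val_nat n : (0 < n)%N -> w n%:R = w p%:R *+ logn p n.
Proof.
move=> n0; have [m pm def_n] := pfactor_coprime p_prime n0.
have m0 : (0 < m)%N by move: n0; rewrite {1}def_n muln_gt0 => /andP[].
have pL0 : p%:R != 0 :> L by rewrite natL_neq0 ?prime_gt0.
rewrite {1}def_n natrM natrX valM; first by rewrite val_coprime // valX // add0r.
  exact: natL_neq0.
exact: expf_neq0.
Qed.

Lemma val_int (m : int) : m != 0 -> w m%:~R = w p%:R *+ logn p `|m|.
Proof.
have valZ n : n%:Z != 0 -> w n%:Z%:~R = w p%:R *+ logn p n.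
  by move=> n0; rewrite -pmulrn [LHS]val_nat // lt0n -eqz_nat.
case: m => n; first exact: valZ.
move=> _; rewrite NegzE abszN mulrNz -mulN1r.
rewrite -pmulrn valM; first by rewrite valN1 add0r pmulrn; apply: valZ.
  by rewrite oppr_eq0 oner_neq0.
exact: natL_neq0.
Qed.

Lemma val_rat (q : rat) : q != 0 -> exists k : int, w q%:A = w p%:R * k.
Proof.
move=> q0; have qA0 : q%:A != 0 :> L by rewrite scaler_eq0 oner_eq0 orbF.
have intA (m : int) : m%:~R%:A = m%:~R :> L by rewrite scaler_int.
have dA0 : (denq q)%:~R != 0 :> L.
  by rewrite -intA scaler_eq0 oner_eq0 orbF intr_eq0 denq_neq0.
have : q%:A * (denq q)%:~R = (numq q)%:~R :> L.
  by rewrite -!intA -scalerAl mul1r scalerA numqE.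
move/(congr1 w); rewrite valM // !val_int ?denq_neq0 ?numq_eq0 //.
move=> /(canRL (addrK _)) ->.
exists ((logn p `|numq q|)%:Z - (logn p `|denq q|)%:Z).
by rewrite mulrBr -!mulrzz -!pmulrn.
Qed.

(** By Horner's rule: q.[pi] is a multiple of pi plus a rational constant, and
    the two have valuations in different residue classes modulo the ramification
    index [w p%:R], so they cannot cancel.  The induction therefore has to carry
    the residue class of the valuation along with the nonvanishing. *)
Lemma val_horner (pi : L) (q : {poly rat}) : pi != 0 -> w pi = 1 -> q != 0 ->
  (size q)%:Z <= w p%:R ->
  (map_poly (in_alg L) q).[pi] != 0 /\
  exists2 j : nat, (j < size q)%N &
    exists k : int, w (map_poly (in_alg L) q).[pi] = w p%:R * k + j%:Z.
Proof.
move=> pi0 wpi.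
elim/poly_ind: q => [|q c IH]; first by rewrite eqxx.
rewrite -size_poly_eq0 rmorphD rmorphM /= map_polyX map_polyC /= hornerMXaddC.
rewrite size_MXaddC; have [->|q0] := eqVneq q 0; rewrite /= ?andbT ?andbF.
  have [//|c0] := eqVneq c 0; rewrite rmorph0 horner0 mul0r add0r => _ _.
  split; first by rewrite scaler_eq0 oner_eq0 orbF.
  have [k wk] := val_rat c0; exists 0%N; first by rewrite size_poly0.
  by exists k; rewrite addr0.
move=> _ size_q.
have [|qpi0 [j jq [k wk]]] := IH q0; first by apply: le_trans size_q; rewrite lez_nat leqnSn.
have qpipi0 : (map_poly (in_alg L) q).[pi] * pi != 0 by rewrite mulf_neq0.
have wqpi : w ((map_poly (in_alg L) q).[pi] * pi) = w p%:R * k + j.+1%:Z.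
  by rewrite valM // wpi wk -addrA -[j.+1]addn1 PoszD.
have [->|c0] := eqVneq c 0.
  rewrite scale0r addr0; split=> //; 
  by exists j.+1 => //; exists k.
have [l wl] := val_rat c0.
have cA0 : c%:A != 0 :> L by rewrite scaler_eq0 oner_eq0 orbF.
have [|s0 ws] := valD_neq qpipi0 cA0.
  rewrite wqpi wl; apply/eqP; apply: residue_neq => //.
  by apply: lt_le_trans size_q; rewrite ltz_nat ltnS.
split=> //; case: ws => ->; first by exists j.+1 => //; exists k.
by exists 0%N => //; exists l; rewrite addr0.
Qed.

(** The minimal polynomial of a uniformizer vanishes at it, so [val_horner]
    bounds its degree from below. *)
Lemma val_p_le_dim : w p%:R <= (\dim {:L})%:Z.
Proof.
have [pi pi0 wpi] : exists2 pi, pi != 0 & w pi = 1 by case: w_above.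
rewrite leNgt; apply/negP => lt.
have /polyOver1P[q def_q] := minPolyOver 1 pi.
have q0 : q != 0.
  by rewrite -(map_poly_eq0 (in_alg L)) -def_q monic_neq0 ?monic_minPoly.
have [|/negP[]] := val_horner pi0 wpi q0; last first.
  by rewrite -def_q minPolyxx.
have -> : size q = size (minPoly 1 pi) by rewrite def_q size_map_poly.
rewrite size_minPoly adjoin_degreeE dimv1 divn1.
move: lt; rewrite -lezD1; apply: le_trans.
by rewrite -PoszD addn1 lez_nat ltnS dimvS ?subvf.
Qed.


(** * Ramification groups *)

Section RamificationElement.
Variables (i : nat) (s : gal_of {:L}).
Hypothesis s_ram : s \in ramification_group w i.

Lemma ram_integral x : val_ge w 0 x -> val_ge w i.+1%:Z (s x - x).
Proof. by move: s_ram x; rewrite inE => /andP[_ /asboolP]. Qed.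

(** Induction on k, splitting off a uniformizer pi: with z = pi z',
    s z - z = s pi (s z' - z') + (s pi - pi) z'. *)
Lemma ram_shift (k : nat) z : val_ge w k%:Z z ->
  val_ge w (k%:Z + i%:Z) (s z - z).
Proof.
have [pi pi0 wpi] : exists2 pi, pi != 0 & w pi = 1 by case: w_above.
elim: k z => [|k IH] z kz.
  by rewrite add0r; apply: val_ge_trans (ram_integral kz); rewrite lez_nat.
have kz' : val_ge w k%:Z (z / pi).
  have -> : k%:Z = k.+1%:Z + (-1) by lia.
  by apply: val_geM => //; right; rewrite valV // wpi.
have pi_int : val_ge w 0 pi by right; rewrite wpi.
have spi : val_ge w 1 (s pi).
  rewrite -[s pi](subrK pi); apply: val_geD; last by right; rewrite wpi.
  by apply: val_ge_trans (ram_integral pi_int); rewrite lez_nat.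
have -> : s z - z = s pi * (s (z / pi) - z / pi) + (s pi - pi) * (z / pi).
  have {1 2}-> : z = pi * (z / pi) by rewrite mulrC divfK.
  by rewrite rmorphM /=; ring.
have -> : k.+1%:Z + i%:Z = 1 + (k%:Z + i%:Z) by lia.
apply: val_geD; first exact: val_geM spi (IH _ kz').
have -> : 1 + (k%:Z + i%:Z) = i.+1%:Z + k%:Z by lia.
exact: val_geM (ram_integral pi_int) kz'.
Qed.

Lemma ram_shift_iter (k n : nat) z : val_ge w k%:Z z ->
  val_ge w (k%:Z + i%:Z) ((s ^+ n)%g z - z).
Proof.
elim: n z => [|n IH] z kz; first by rewrite expg0 gal_id subrr; left.
rewrite expgS galM ?memvf // -[X in X - z](subrK (s z)) -addrA.
have sz := ram_shift kz; apply: val_geD (sz); apply: IH.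
rewrite -[s z](subrK z); apply: val_geD => //.
by apply: val_ge_trans sz; rewrite lerDl.
Qed.

(** The elements (s ^+ k) y with y = s x - x add up to s^m x - x = 0, and each of
    them is y up to valuation w(y) + i; hence m y has valuation at least
    w(y) + i. *)
Lemma ram_index_le (m : nat) : s != 1%g -> (0 < m)%N -> (s ^+ m = 1)%g ->
  i%:Z <= w m%:R.
Proof.
move=> s1 m0 sm.
have [x sx] : exists x, s x != x.
  apply: contrapT => /forallNP sx; case/negP: s1; apply/gal_eqP => x _.
  by rewrite gal_id; apply/eqP; apply: contrapT => /negP; apply: sx.
wlog x_int : x sx / val_ge w 0 x.
  (* A power of p is fixed by s and makes x integral. *)
  have p0 : p%:R != 0 :> L by rewrite natL_neq0 ?prime_gt0.
  move=> IH; apply: (IH (x * p%:R ^+ `|w x|)).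
    rewrite rmorphM rmorphXn rmorph_nat /= -subr_eq0 -mulrBl mulf_neq0 ?subr_eq0 //.
    exact: expf_neq0.
  have [->|x0] := eqVneq x 0; first by rewrite mul0r; left.
  right; rewrite valM ?expf_neq0 // valX //.
  move: (w p%:R) val_p_gt0 (w x) => e e0 v.
  rewrite pmulrn mulrzz; have : `|v|%N%:Z <= e * `|v|%N%:Z by rewrite ler_peMl.
  by move: (e * _) => q; lia.
pose y := s x - x.
have y0 : y != 0 by rewrite subr_eq0.
have [wy wyE] : exists wy : nat, w y = wy%:Z.
  have := ram_integral x_int; rewrite -/y val_geP //.
  by case: (w y) => // wy _; exists wy.
have sum0 : \sum_(0 <= k < m) (s ^+ k)%g y = 0.
  rewrite (eq_bigr (fun k => (s ^+ k.+1)%g x - (s ^+ k)%g x)); last first.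
    by move=> k _; rewrite rmorphB /= expgS galM ?memvf.
  by rewrite telescope_sumr // sm expg0 subrr.
have : val_ge w (wy%:Z + i%:Z) (m%:R * y).
  have -> : m%:R * y = - \sum_(0 <= k < m) ((s ^+ k)%g y - y).
    by rewrite big_split /= sum0 add0r sumr_const_nat subn0 -mulNrn opprK mulr_natl.
  apply/val_geN/val_ge_sum => k; apply: ram_shift_iter.
  by right; rewrite wyE.
by rewrite val_geP ?mulf_neq0 ?natL_neq0 // valM ?natL_neq0 // wyE addrC lerD2r.
Qed.

End RamificationElement.


Lemma galois_full : galois 1 {:L}.
Proof.
rewrite /galois sub1v normalFieldf andbT /=; apply/separableP => x _.
apply: pcharf0_separable => q; rewrite !inE.
by case q_pr: (prime q) => //=; apply/negbTE/natL_neq0/prime_gt0.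
Qed.

Lemma card_gal : #|'Gal({:L} / 1)%g| = \dim {:L}.
Proof. by rewrite -(galois_dim galois_full) dimv1 divn1. Qed.

(** In [ram_index_le] take for m the degree d, which kills the Galois group: the
    valuation of d is the ramification index, at most d, times the exponent of p
    in d. *)
Lemma ram_trivial i : (\dim {:L} * \dim {:L} < i)%N ->
  ramification_group w i \subset [1 gal_of {:L}]%g.
Proof.
move=> lti; apply/fintype.subsetP => s s_ram; rewrite inE; apply: contraLR lti => s1.
have s_gal : s \in 'Gal({:L} / 1)%g by move: s_ram; rewrite inE => /andP[].
have d0 : (0 < \dim {:L})%N by rewrite -card_gal cardG_gt0.
have sd : (s ^+ \dim {:L} = 1)%g by rewrite -card_gal expg_cardG.
move: (\dim _) d0 sd val_p_le_dim => d d0 sd le_d.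
rewrite -leqNgt -lez_nat; apply: le_trans (ram_index_le s_ram s1 d0 sd) _.
rewrite val_nat // pmulrn mulrzz PoszM.
have lt_log : (logn p d < d)%N.
  by apply: leq_trans (ltn_expl _ (prime_gt1 p_prime)) (dvdn_leq d0 (pfactor_dvdnn _ _)).
apply: ler_pM; rewrite ?lez_nat ?(ltnW lt_log) //.
exact: ltW val_p_gt0.
Qed.

End Valuation.

(** * Points of order three *)

Definition division_poly3 (K : comNzRingType) (W : weierstrass K) : {poly K} :=
  Poly [:: b8 W; 3 * b6 W; 3 * b4 W; b2 W; 3].

(** Its roots are the ordinates of the points with abscissa x. *)
Definition fibre_poly (K : comNzRingType) (W : weierstrass K) (x : K) : {poly K} :=
  Poly [:: - (x ^+ 3 + a2 W * x ^+ 2 + a4 W * x + a6 W); a1 W * x + a3 W; 1].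

(** A point P = (x, y) has order three when 2 P = - P, that is when the tangent at
    P, of slope l, meets the curve again at P: l^2 + a1 l = 3 x + a2.  Clearing
    the denominator of l and eliminating y with the equation of the curve leaves
    the quartic. *)
Lemma torsion3_root (K : fieldType) (W : weierstrass K) (x y : K) :
  torsion W 3 (Some (x, y)) ->
  root (division_poly3 W) x /\ root (fibre_poly W x) y.
Proof.
case=> /= Wxy; rewrite eqxx /=.
case: eqP => [//|/eqP].
set D := _ + _ + _; set n := (3 * _ + _ + _ - _); move=> D0.
have -> : 2 * y + a1 W * x + a3 W = D by rewrite /D; ring.
set l := n / D; case: ifP => // /andP[/eqP x3 _] _.
have nD : n = l * D by rewrite divfK.
pose C := y ^+ 2 + a1 W * x * y + a3 W * y
  - (x ^+ 3 + a2 W * x ^+ 2 + a4 W * x + a6 W).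
have C0 : C = 0 by rewrite /C Wxy subrr.
split; rewrite rootE; last first.
  by apply/eqP; rewrite -[RHS]C0 /C /fibre_poly horner_Poly /=; ring.
have E1 : l ^+ 2 + a1 W * l = 3 * x + a2 W.
  move/eqP: x3; rewrite -subr_eq0 => /eqP x3.
  by apply: subr0_eq; rewrite -[RHS]oppr0 -x3; ring.
apply/eqP; transitivity ((3 * x + a2 W) * D ^+ 2 - n * (n + a1 W * D)
                         - (4 * (3 * x + a2 W) + a1 W ^+ 2) * C).
  rewrite /division_poly3 horner_Poly /= /n /D /C /b8 /b6 /b4 /b2; ring.
by rewrite C0 -E1 nD; ring.
Qed.

Lemma roots_bound (K : fieldType) (q : {poly K}) : q != 0 ->
  exists2 s : seq K, (size s < size q)%N & forall x, root q x -> x \in s.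
Proof.
have [n] := ubnP (size q); elim: n q => // n IH q /ltnSE le_qn q0.
have [[a qa]|noroot] := pselect (exists a, root q a); last first.
  exists [::]; first by rewrite size_poly_gt0.
  by move=> x qx; case: noroot; exists x.
have /factor_theorem[q' def_q] := qa.
have q'0 : q' != 0 by apply: contraNneq q0 => q'0; rewrite def_q q'0 mul0r.
have size_q : size q = (size q').+1.
  by rewrite def_q size_Mmonic ?monicXsubC ?size_XsubC ?addn2.
have [|s s_q' root_s] := IH q' _ q'0; first by rewrite -size_q.
exists (a :: s); first by rewrite size_q /= ltnS.
move=> x; rewrite def_q rootM root_XsubC inE => /orP[/root_s->|->] //.
by rewrite orbT.
Qed.

Lemma division_poly3_neq0 (K : fieldType) (W : weierstrass K) :
  (3 : K) != 0 -> division_poly3 W != 0 /\ (size (division_poly3 W) <= 5)%N.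
Proof.
move=> n3; split; last exact: size_Poly.
apply: contraNneq n3 => /(congr1 (fun q : {poly K} => q`_4)).
by rewrite coef_Poly coef0 /= => ->.
Qed.

Lemma fibre_poly_neq0 (K : fieldType) (W : weierstrass K) x :
  fibre_poly W x != 0 /\ (size (fibre_poly W x) <= 3)%N.
Proof.
split; last exact: size_Poly.
apply: contraNneq (oner_neq0 K) => /(congr1 (fun q : {poly K} => q`_2)).
by rewrite coef_Poly coef0 /= => ->.
Qed.

Lemma torsion3_list (K : fieldType) (W : weierstrass K) : (3 : K) != 0 ->
  exists2 S : seq (K * K), (size S <= 8)%N &
    forall x y, root (division_poly3 W) x -> root (fibre_poly W x) y -> (x, y) \in S.
Proof.
move=> n3; have [d0 d5] := division_poly3_neq0 W n3.
have [xs size_xs xsP] := roots_bound d0.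
have /choice[ys ysP] x : exists s : seq K, (size s <= 2)%N /\
    forall y, root (fibre_poly W x) y -> y \in s.
  have [f0 f3] := fibre_poly_neq0 W x; have [s s_f sP] := roots_bound f0.
  by exists s; split=> //; rewrite -ltnS (leq_trans s_f).
exists [seq (x, y) | x <- xs, y <- ys x]; last first.
  move=> x y dx fy; apply/allpairsPdep; exists x, y; split=> //; first exact: xsP.
  by have [_] := ysP x; apply.
rewrite size_allpairs_dep; have : (size xs <= 4)%N by rewrite -ltnS (leq_trans size_xs).
suff: (sumn [seq size (ys x) | x <- xs] <= 2 * size xs)%N by lia.
elim: xs {size_xs xsP} => //= x xs; have [] := ysP x; lia.
Qed.

Section RingMorphism.
Variables (K K' : fieldType) (f : {rmorphism K -> K'}) (W : weierstrass K).

Lemma division_poly3_rmorph x :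
  (division_poly3 (map_weierstrass f W)).[f x] = f (division_poly3 W).[x].
Proof.
case: W => c1 c2 c3 c4 c6.
rewrite /division_poly3 /b8 /b6 /b4 /b2 !horner_Poly /=.
by rewrite !(rmorph_nat, rmorph0, rmorphXn, rmorphM, rmorphN, rmorphD).
Qed.

Lemma fibre_poly_rmorph x y :
  (fibre_poly (map_weierstrass f W) (f x)).[f y] = f (fibre_poly W x).[y].
Proof.
case: W => c1 c2 c3 c4 c6; rewrite /fibre_poly !horner_Poly /=.
by rewrite !(rmorph1, rmorph0, rmorphXn, rmorphM, rmorphN, rmorphD).
Qed.

End RingMorphism.

Section DivisionField3.
Variables (E : weierstrass rat) (L : splittingFieldType rat).
Let EL : weierstrass L := map_weierstrass ratr E.

Lemma gal_ratr (s : gal_of {:L}) (q : rat) : s (ratr q) = ratr q.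
Proof. exact: fmorph_rat. Qed.

Lemma gal_torsion3 (s : gal_of {:L}) x y :
  root (division_poly3 EL) x -> root (fibre_poly EL x) y ->
  root (division_poly3 EL) (s x) /\ root (fibre_poly EL (s x)) (s y).
Proof.
have fixE : map_weierstrass s EL = EL.
  by rewrite /EL /map_weierstrass /= !gal_ratr.
rewrite !rootE => /eqP dx /eqP fy.
have := division_poly3_rmorph s EL x; rewrite fixE dx rmorph0 => ->.
by have := fibre_poly_rmorph s EL x y; rewrite fixE fy rmorph0 => ->.
Qed.

Lemma three_neq0 : (3 : L) != 0.
Proof. exact: (@natL_neq0 L 3). Qed.

(** An automorphism is determined by its action on the points of order three,
    because these generate L.  The action is recorded by the positions, in a
    list of at most eight points, of the images of the points of the list. *)
Lemma division_field_dim (iota : {rmorphism L -> algC}) :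
  is_division_field E 3 iota -> (\dim {:L} <= #|{ffun 'I_8 -> 'I_9}|)%N.
Proof.
move=> [_ generated]; have [S sizeS inS] := torsion3_list EL three_neq0.
pose act (s : gal_of {:L}) (P : L * L) := (s P.1, s P.2).
(* Positions are taken in 'I_9 because the index of a point outside the list is
   the length of the list, which may be 8. *)
pose f (s : gal_of {:L}) : {ffun 'I_8 -> 'I_9} :=
  [ffun i : 'I_8 => inord (index (act s (nth (0, 0) S i)) S)].
have f_inj : {in 'Gal({:L} / 1)%g &, injective f}.
  move=> s t _ _ fst; pose u := (s * t^-1)%g.
  have u_full : fixedField [set u] = {:L}%VS.
    apply: (generated [aspace of fixedField [set u]]) => x y /torsion3_root[dx fy].
    have [[dsx fsy] [dtx fty]] := (gal_torsion3 s dx fy, gal_torsion3 t dx fy).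
    have inS8 P : P \in S -> (index P S < 8)%N.
      by rewrite -index_mem => /leq_trans; apply.
    have xyS := inS _ _ dx fy; have i8 := inS8 _ xyS.
    have /(congr1 (@nat_of_ord 9)) :
      f s (Ordinal i8) = f t (Ordinal i8) by rewrite fst.
    rewrite !ffunE /= nth_index // /act /=.
    rewrite !inordK ?ltnS 1?ltnW ?inS8 ?inS // => /(congr1 (nth (0, 0) S)).
    rewrite !nth_index ?inS // => -[sxt syt].
    have uK a : s a = t a -> u a = a.
      by move=> sta; rewrite galM ?memvf // sta -galM ?memvf // mulgV gal_id.
    by split; apply/fixedFieldP; rewrite ?memvf // => v /set1P->; apply: uK.
  apply/eqP/gal_eqP => z _; have : z \in fixedField [set u] by rewrite u_full memvf.
  case/mem_fixedFieldP => _ /(_ u (set11 u)) uz.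
  by rewrite -{2}uz -galM ?memvf // mulgKV.
by rewrite -card_gal -(card_in_image f_inj) max_card.
Qed.

End DivisionField3.

(** * A bound for the wild part of the conductor at 2 *)

Lemma card_fset_set_le (T : choiceType) (A : set T) (r : seq T) :
  (forall x, A x -> x \in r) -> (#|` fset_set A| <= size r)%N.
Proof.
move=> Ar; have [finA|infA] := pselect (finite_set A); last first.
  by rewrite /fset_set; case: pselect => // _; rewrite cardfs0.
apply: uniq_leq_size (fset_uniq _) _ => x.
by rewrite in_fset_set // inE => /Ar.
Qed.

Lemma fixed_codim3_le2 (E : weierstrass rat) (L : splittingFieldType rat)
  (G : {set gal_of {:L}}) : (fixed_codim E 3 G <= 2)%N.
Proof.
have [S sizeS inS] := torsion3_list (map_weierstrass ratr E) (three_neq0 L).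
apply: leq_trans (leq_subr _ _) _.
have le9 : (#|` fset_set (torsion_over E 3 (L := L))| <= 9)%N.
  apply: leq_trans (_ : (size (None :: map Some S) <= 9)%N); last first.
    by rewrite /= size_map ltnS.
  apply: card_fset_set_le => -[[x y]|] tor; rewrite inE //=.
  by apply/mapP; exists (x, y) => //; have [] := torsion3_root tor; apply: inS.
move: (#|` _ |) le9 => n n9; case: (posnP n) => [->|n0]; first by rewrite logn0.
rewrite -ltnS -(ltn_exp2l _ _ (isT : (1 < 3)%N)).
by apply: leq_ltn_trans (dvdn_leq n0 (pfactor_dvdnn 3 n)) (leq_ltn_trans n9 _).
Qed.

Lemma fixed_codim_trivial (E : weierstrass rat) (L : splittingFieldType rat) l
  (G : {set gal_of {:L}}) : G \subset [1 gal_of {:L}]%g -> fixed_codim E l G = 0%N.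
Proof.
move=> /fintype.subsetP G1; rewrite /fixed_codim.
suff -> : fixed_torsion E l G = torsion_over E l (L := L) by rewrite subnn.
apply/seteqP; split=> [P []|P tor] //; split=> // s /G1; rewrite inE => /eqP->.
by case: P {tor} => [[x y]|] //=; rewrite !gal_id.
Qed.

Lemma sum_bounded_support (F : nat -> nat) (c D M : nat) :
  (forall i, F i <= c)%N -> (forall i, D < i -> F i = 0)%N ->
  (\sum_(1 <= i < M) F i <= D * c)%N.
Proof.
move=> Fc F0; suff : (\sum_(1 <= i < M) F i <= minn M.-1 D * c)%N.
  by move/leq_trans; apply; rewrite leq_mul2r geq_minr orbT.
elim: M => [|[|M] IH]; try by rewrite big_geq.
rewrite big_nat_recr //=; have [DM|MD] := ltnP D M.+1.
  rewrite F0 // addn0; apply: leq_trans IH _.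
  by rewrite leq_mul2r; apply/orP; right; rewrite /=; lia.
apply: leq_trans (leq_add IH (Fc M.+1)) _.
have -> : minn M.+1.-1 D = M by apply/minn_idPl/ltnW.
by rewrite mulSn addnC.
Qed.

(** If d bounds the degree of the division field, the ramification groups beyond
    the index d^2 are trivial, and each of the earlier terms of the sum is at
    most 2 #G_0. *)
Lemma wild_exponent2_bounded :
  exists K, forall E, (wild_exponent E 2 <= K)%N.
Proof.
pose d := #|{ffun 'I_8 -> 'I_9}|.
exists (d * d * 2)%N => E; rewrite /wild_exponent; case: xgetP => // n _.
move=> [L [iota [w [M [div_field w_above _ swan]]]]].
have dim_d := division_field_dim div_field.
set G := ramification_group w in swan.
have G0 : (0 < #|G 0%N|)%N.
  apply/card_gt0P; exists 1%g; rewrite inE group1 /=.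
  by apply/asboolP => x _; rewrite gal_id subrr; left.
have GS i : G i \subset G 0%N.
  apply/fintype.subsetP => s; rewrite !inE => /andP[-> /asboolP s_i].
  apply/asboolP => x x_int.
  by apply: val_ge_trans (s_i x x_int); rewrite lez_nat.
rewrite -(leq_pmul2r G0) -swan -!mulnA [X in (_ <= d * X)%N]mulnA mulnA.
apply: leq_trans (sum_bounded_support M (c := 2 * #|G 0%N|) (D := d * d) _ _) _
  => [i|i ltdi|].
- by rewrite mulnC leq_mul ?fixed_codim3_le2 ?subset_leq_card.
- rewrite fixed_codim_trivial ?muln0 //; apply: (ram_trivial (p := 2)) => //.
  by apply: leq_ltn_trans ltdi; apply: leq_mul.
- lia.
Qed.


(** * The p-adic valuation of rational numbers *)

Section PadicVal.
Variable p : nat.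
Hypothesis p_prime : prime p.

Lemma padic_val_frac (m n : int) : m != 0 -> n != 0 ->
  padic_val p (m%:~R / n%:~R) = (logn p `|m|)%:Z - (logn p `|n|)%:Z.
Proof.
move=> m0 n0; set x := _ / _; have n0' : n%:~R != 0 :> rat by rewrite intr_eq0.
have x0 : x != 0 by rewrite mulf_neq0 ?invr_eq0 // intr_eq0.
have : numq x * n = m * denq x.
  apply/eqP; rewrite -(eqr_int rat) !rmorphM /= numqE /x; apply/eqP; field.
  exact: n0'.
move/(congr1 (fun k => logn p `|k|)); rewrite !abszM.
by rewrite !lognM ?absz_gt0 ?numq_eq0 ?denq_neq0 // /padic_val; lia.
Qed.

Lemma padic_val_int (m : int) : padic_val p m%:~R = (logn p `|m|)%:Z.
Proof. by rewrite /padic_val numq_int denq_int logn1 subr0. Qed.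

Lemma padic_valM x y : x != 0 -> y != 0 ->
  padic_val p (x * y) = padic_val p x + padic_val p y.
Proof.
move=> x0 y0; rewrite -{1}(divq_num_den x) -{1}(divq_num_den y) mulf_div -!rmorphM /=.
rewrite padic_val_frac ?mulf_neq0 ?numq_eq0 ?denq_neq0 // !abszM.
rewrite !lognM ?absz_gt0 ?numq_eq0 ?denq_neq0 // !PoszD.
by rewrite opprD addrACA.
Qed.

Lemma padic_valX x n : x != 0 -> padic_val p (x ^+ n) = padic_val p x *+ n.
Proof.
move=> x0; elim: n => [|n IHn]; first by rewrite expr0 (padic_val_int 1) logn1.
by rewrite exprS padic_valM ?expf_neq0 // IHn mulrS.
Qed.

Lemma padic_valXM x y n : x != 0 -> y != 0 ->
  padic_val p (x ^+ n * y) = padic_val p x *+ n + padic_val p y.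
Proof. by move=> x0 y0; rewrite padic_valM ?expf_neq0 // padic_valX. Qed.

Lemma padic_integer_frac (m n : int) : ~~ (p %| `|n|)%N ->
  padic_integer p (m%:~R / n%:~R).
Proof.
move=> pn; have n0 : n != 0 by apply: contraNneq pn => ->; rewrite dvdn0.
rewrite /padic_integer; set x := _ / _; apply: contra pn => /dvdn_trans; apply.
have n0' : n%:~R != 0 :> rat by rewrite intr_eq0.
have : numq x * n = m * denq x.
  apply/eqP; rewrite -(eqr_int rat) !rmorphM /= numqE /x; apply/eqP; field.
  exact: n0'.
move/(congr1 absz); rewrite !abszM => E.
rewrite -(Gauss_dvdr _ (n := `|numq x|)) ?E ?dvdn_mull //.
by rewrite coprime_sym coprime_num_den.
Qed.

Lemma padic_integer_int (m : int) : padic_integer p m%:~R.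
Proof. by rewrite /padic_integer denq_int dvdn1 neq_ltn prime_gt1 // orbT. Qed.

Lemma padic_integerM x y :
  padic_integer p x -> padic_integer p y -> padic_integer p (x * y).
Proof.
move=> px py; rewrite -(divq_num_den x) -(divq_num_den y) mulf_div -!rmorphM /=.
by apply: padic_integer_frac; rewrite abszM Euclid_dvdM // negb_or px.
Qed.

Lemma padic_integerD x y :
  padic_integer p x -> padic_integer p y -> padic_integer p (x + y).
Proof.
move=> px py; rewrite -(divq_num_den x) -(divq_num_den y).
rewrite addf_div ?intr_eq0 ?denq_neq0 // -!rmorphM -rmorphD /=.
by apply: padic_integer_frac; rewrite abszM Euclid_dvdM // negb_or px.
Qed.

Lemma padic_integerN x : padic_integer p x -> padic_integer p (- x).
Proof. by rewrite /padic_integer denqN. Qed.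

Lemma padic_integer_ge0 x : padic_integer p x -> 0 <= padic_val p x.
Proof.
by move=> px; rewrite /padic_val (lognE p `|denq x|) (negbTE px) !andbF subr0.
Qed.

End PadicVal.

(** * Minimality of Weierstrass equations *)

Definition c4 (K : comNzRingType) (W : weierstrass K) : K := b2 W ^+ 2 - 24 * b4 W.

Section ChangeOfModel.
Variable K : fieldType.
Implicit Types E W : weierstrass K.

(** The intermediate b2, b4, b6, b8 change by polynomials in r alone; working
    with them keeps the two identities small. *)
Lemma isomorphic_invariants E W : isomorphic E W ->
  exists u : K, [/\ u != 0, u ^+ 4 * c4 W = c4 E &
                    u ^+ 12 * discriminant W = discriminant E].
Proof.
move=> [u [r [s [t [u0 [e1 e2 e3 e4 e6]]]]]]; exists u.
have B2 : u ^+ 2 * b2 W = b2 E + 12 * r.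
  rewrite /b2; transitivity ((u * a1 W) ^+ 2 + 4 * (u ^+ 2 * a2 W)); first ring.
  by rewrite e1 e2; ring.
have B4 : u ^+ 4 * b4 W = b4 E + r * b2 E + 6 * r ^+ 2.
  rewrite /b4 /b2.
  transitivity (2 * (u ^+ 4 * a4 W) + (u * a1 W) * (u ^+ 3 * a3 W)); first ring.
  by rewrite e1 e3 e4; ring.
have B6 : u ^+ 6 * b6 W = b6 E + 2 * r * b4 E + r ^+ 2 * b2 E + 4 * r ^+ 3.
  rewrite /b6 /b4 /b2; transitivity ((u ^+ 3 * a3 W) ^+ 2 + 4 * (u ^+ 6 * a6 W)); first ring.
  by rewrite e3 e6; ring.
have B8 : u ^+ 8 * b8 W = b8 E + 3 * r * b6 E + 3 * r ^+ 2 * b4 E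
    + r ^+ 3 * b2 E + 3 * r ^+ 4.
  rewrite /b8 /b6 /b4 /b2.
  transitivity ((u * a1 W) ^+ 2 * (u ^+ 6 * a6 W) + 4 * (u ^+ 2 * a2 W) * (u ^+ 6 * a6 W)
     - (u * a1 W) * (u ^+ 3 * a3 W) * (u ^+ 4 * a4 W)
     + (u ^+ 2 * a2 W) * (u ^+ 3 * a3 W) ^+ 2 - (u ^+ 4 * a4 W) ^+ 2); first ring.
  by rewrite e1 e2 e3 e4 e6; ring.
split=> //.
  rewrite /c4; transitivity ((u ^+ 2 * b2 W) ^+ 2 - 24 * (u ^+ 4 * b4 W)); first ring.
  by rewrite B2 B4; ring.
rewrite /discriminant.
transitivity (- (u ^+ 2 * b2 W) ^+ 2 * (u ^+ 8 * b8 W) - 8 * (u ^+ 4 * b4 W) ^+ 3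
  - 27 * (u ^+ 6 * b6 W) ^+ 2
  + 9 * (u ^+ 2 * b2 W) * (u ^+ 4 * b4 W) * (u ^+ 6 * b6 W)); first ring.
rewrite B2 B4 B6 B8 /b8 /b6 /b4 /b2; ring.
Qed.
End ChangeOfModel.

Section MinimalModels.
Variable p : nat.
Hypothesis p_prime : prime p.
Implicit Types E W : weierstrass rat.

Lemma padic_integer_nat n : padic_integer p n%:R.
Proof. exact: (padic_integer_int p_prime n). Qed.

Lemma padic_integerX x n : padic_integer p x -> padic_integer p (x ^+ n).
Proof.
move=> px; elim: n => [|n IHn]; first exact: (padic_integer_nat 1).
by rewrite exprS; apply: padic_integerM.
Qed.

Lemma padic_integral_invariants W : padic_integral p W ->
  padic_integer p (c4 W) /\ padic_integer p (discriminant W).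
Proof.
case=> h1 h2 h3 h4 h6; rewrite /c4 /discriminant /b8 /b6 /b4 /b2.
split; repeat lazymatch goal with
  | |- padic_integer _ (_ + _) => apply: (padic_integerD p_prime)
  | |- padic_integer _ (- _) => apply: padic_integerN
  | |- padic_integer _ (_ * _) => apply: (padic_integerM p_prime)
  | |- padic_integer _ (_ ^+ _) => apply: padic_integerX
  | |- padic_integer _ _%:R => apply: padic_integer_nat
  | |- _ => assumption
  end.
Qed.

(** Passing to another p-integral equation changes the valuation of the
    discriminant by a multiple 12 k and that of c4 by 4 k.  Neither may become
    negative, so either bound forces the discriminant not to drop. *)
Lemma minimal_model_criterion E W :
  isomorphic E W -> padic_integral p W -> discriminant E != 0 ->
  padic_val p (discriminant W) < 12 \/
    c4 W != 0 /\ padic_val p (c4 W) < 4 ->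
  minimal_model_at p E W.
Proof.
move=> EW intW dE crit; split=> // W' EW' intW'.
have [u [u0 c4u du]] := isomorphic_invariants EW.
have [v [v0 c4v dv]] := isomorphic_invariants EW'.
have d0 : discriminant W != 0 by apply: contraNneq dE => d0; rewrite -du d0 mulr0.
have d0' : discriminant W' != 0 by apply: contraNneq dE => d0'; rewrite -dv d0' mulr0.
have [c4_ge0 d_ge0] := padic_integral_invariants intW'.
move/padic_integer_ge0: d_ge0 => d_ge0.
have /(congr1 (padic_val p)) : u ^+ 12 * discriminant W = v ^+ 12 * discriminant W'.
  by rewrite du dv.
rewrite !padic_valXM //.
case: crit => [|[c40]].
  move: (padic_val p (discriminant W)) (padic_val p (discriminant W')) d_ge0.
  move: (padic_val p u) (padic_val p v) => a b d d'; lia.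
have /(congr1 (padic_val p)) : u ^+ 4 * c4 W = v ^+ 4 * c4 W' by rewrite c4u c4v.
have c40' : c4 W' != 0.
  apply: contraTneq (mulf_neq0 (expf_neq0 4 u0) c40) => c40'.
  by rewrite c4u -c4v c40' mulr0 eqxx.
move/padic_integer_ge0: c4_ge0 => c4_ge0.
rewrite !padic_valXM //.
move: (padic_val p (discriminant W)) (padic_val p (discriminant W')) c4_ge0.
move: (padic_val p u) (padic_val p v) (padic_val p _) (padic_val p _) => a b c c' d d'; lia.
Qed.

Lemma minimal_model_val E W W' :
  minimal_model_at p E W -> minimal_model_at p E W' ->
  padic_val p (discriminant W) = padic_val p (discriminant W').
Proof.
move=> [EW intW minW] [EW' intW' minW']; apply/eqP; rewrite eq_le.
by rewrite minW // minW'.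
Qed.

Lemma padic_integral_int (W : weierstrass int) :
  padic_integral p (map_weierstrass intr W).
Proof. by split; apply: padic_integer_int. Qed.

End MinimalModels.

Lemma discriminant_intr (W : weierstrass int) :
  discriminant (map_weierstrass (intr : int -> rat) W) = (discriminant W)%:~R.
Proof.
case: W => A1 A2 A3 A4 A6; rewrite /discriminant /b8 /b6 /b4 /b2 /=.
by rewrite !(rmorph_nat, rmorphXn, rmorphM, rmorphN, rmorphD).
Qed.

Lemma c4_intr (W : weierstrass int) :
  c4 (map_weierstrass (intr : int -> rat) W) = (c4 W)%:~R.
Proof.
case: W => A1 A2 A3 A4 A6; rewrite /c4 /b4 /b2 /=.
by rewrite !(rmorph_nat, rmorphXn, rmorphM, rmorphN, rmorphD).
Qed.

Lemma global_minimal_disc_neq0 E W : discriminant E != 0 ->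
  global_minimal_model E W -> discriminant W != 0.
Proof.
move=> dE /(_ 2%N isT) [EW _ _].
have [u [_ _ du]] := isomorphic_invariants EW.
apply: contraNneq dE => d0; by rewrite -du discriminant_intr d0 mulr0.
Qed.

(** Two global minimal models have discriminants of the same valuation at every
    prime. *)
Lemma minimal_discriminant_abs E W : discriminant E != 0 ->
  global_minimal_model E W ->
  `|minimal_discriminant E|%N = `|discriminant W|%N.
Proof.
move=> dE minW; rewrite /minimal_discriminant; case: xgetP => [d _|]; last first.
  by move/(_ (discriminant W)); case; exists W.
case=> W' minW' ->; apply: eqn_from_log;
  rewrite ?absz_gt0 ?(global_minimal_disc_neq0 dE) //.
move=> p; have [p_prime|/negbTE np] := boolP (prime p); last first.
  by rewrite [LHS]lognE [RHS]lognE np.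
have := minimal_model_val (minW' p p_prime) (minW p p_prime).
by rewrite !discriminant_intr !padic_val_int => -[].
Qed.

(** * Minimal models of the parity Frey curves *)

Lemma frey_orientation T : parity_class T ->
  exists al be : nat,
    [/\ frey T = frey_equation al%:R be%:R, abc T = (al * be * (al + be))%N,
        tc T = (al + be)%N & [/\ coprime al be, odd al, odd be &
        (4 %| al + be)%N -> (al %% 4 = 1)%N]].
Proof.
case: T => a b c [/= [a0 b0 c0] [cab cac cbc] abc [oa ob oc]].
rewrite /frey /Defs.abc /= -abc; case: ifP => [/andP[dvd4 a1]|cond].
  exists b, a; rewrite [(b + a)%N]addnC [(b * a)%N]mulnC coprime_sym; split=> //.
  split=> // _; move: dvd4 a1 oa ob; lia.
exists a, b; split=> //; split=> // dvd4.
by move: cond; rewrite dvd4 /= => /negbFE/eqP.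
Qed.

Section FreyModels.
Variables al be : nat.
Hypotheses (co : coprime al be) (oal : odd al) (obe : odd be).
Let E := frey_equation al%:R be%:R.

Lemma frey_discriminant :
  discriminant E = 16 * ((al * be * (al + be))%N%:R) ^+ 2.
Proof.
rewrite /E /frey_equation /discriminant /b8 /b6 /b4 /b2 /= !(natrM, natrD); ring.
Qed.

Lemma frey_discriminant_neq0 : discriminant E != 0.
Proof.
rewrite frey_discriminant mulf_neq0 // expf_neq0 // pnatr_eq0 -lt0n.
by rewrite !muln_gt0 addn_gt0 !odd_gt0.
Qed.

(** Modulo a prime dividing one of al, be, al + be, the form
    al^2 + al be + be^2 reduces to the square of one of al, be that this prime
    does not divide. *)
Lemma frey_c4_coprime p : prime p -> (p %| al * be * (al + be))%N ->
  ~~ (p %| al ^ 2 + al * be + be ^ 2)%N.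
Proof.
move=> p_prime p_abc; apply/negP => p_c4.
have p1 : ~~ ((p %| al) && (p %| be))%N.
  rewrite -dvdn_gcd (eqP co) dvdn1 neq_ltn prime_gt1 //.
  by rewrite orbT.
have dvdX2 x : (p %| x ^ 2)%N = (p %| x)%N by rewrite Euclid_dvdX // andbT.
move: p_abc p_c4; rewrite !Euclid_dvdM // -orbA => /or3P[p_al|p_be|p_c].
- have p_mul : (p %| al ^ 2 + al * be)%N by rewrite dvdn_add ?dvdX2 ?dvdn_mulr.
  by rewrite (dvdn_addr _ p_mul) dvdX2 => p_be; case/negP: p1; rewrite p_al.
- have p_mul : (p %| al * be)%N by rewrite dvdn_mull.
  have p_sq : (p %| be ^ 2)%N by rewrite dvdX2.
  rewrite (dvdn_addl _ p_sq) (dvdn_addl _ p_mul) dvdX2 => p_al.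
  by case/negP: p1; rewrite p_al.
have p_mul : (p %| al ^ 2 + al * be)%N by rewrite -mulnn -mulnDr dvdn_mull.
rewrite (dvdn_addr _ p_mul) dvdX2 => p_be.
by case/negP: p1; rewrite p_be andbT -(dvdn_addl _ p_be).
Qed.

Definition short_model : weierstrass int :=
  Weierstrass 0 (be%:Z - al%:Z) 0 (- (al%:Z * be%:Z)) 0.

(** With al + c - 1 = 4 k and c = 16 m, this is the image of the Frey equation
    under x = 4 x' + al, y = 8 y' + 4 x': moving the root al to the origin leaves
    the roots - al and - c, so that the coefficient of x becomes divisible
    by 16. *)
Definition reduced_model (k m : nat) : weierstrass int :=
  Weierstrass 1 k%:Z 0 (al%:Z * m%:Z) 0.

Lemma map_short_model : map_weierstrass intr short_model = E.
Proof.
rewrite /map_weierstrass /E /frey_equation /=.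
by rewrite !(rmorphB, rmorphN, rmorphM) /= rmorph0.
Qed.

Lemma isomorphic_refl (K : fieldType) (W : weierstrass K) : isomorphic W W.
Proof. by exists 1, 0, 0, 0; split; [exact: oner_neq0 | split; ring]. Qed.

Lemma isomorphic_reduced (k m : nat) : (al + (al + be) = 1 + 4 * k)%N ->
  (al + be = 16 * m)%N -> isomorphic E (map_weierstrass intr (reduced_model k m)).
Proof.
move=> ek' em'.
have ek : al%:R + (al%:R + be%:R) = 1 + 4 * k%:R :> rat.
  by rewrite -!natrD ek' natrD natrM.
have em : al%:R + be%:R = 16 * m%:R :> rat by rewrite -natrD em' natrM.
exists 2, al%:R, 1, 0; split=> //=; rewrite rmorphM /= -!pmulrn; split.
- ring.
- transitivity (1 + 4 * k%:R - 1 : rat); first ring. by rewrite -ek; ring.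
- ring.
- transitivity (al%:R * (16 * m%:R) : rat); first ring. by rewrite -em; ring.
- ring.
Qed.

Lemma short_model_minimal p : prime p ->
  (p = 2%N -> (logn 2 (al + be) <= 3)%N) -> minimal_model_at p E E.
Proof.
move=> p_prime le3; apply: (minimal_model_criterion p_prime (isomorphic_refl _)).
- by rewrite -map_short_model; apply: padic_integral_int.
- exact: frey_discriminant_neq0.
rewrite frey_discriminant.
have -> : 16 * (al * be * (al + be))%:R ^+ 2
    = (16 * (al * be * (al + be)) ^ 2)%N%:Z%:~R :> rat.
  by rewrite -pmulrn [RHS]natrM natrX.
have abc0 : (0 < al * be * (al + be))%N by rewrite !muln_gt0 addn_gt0 !odd_gt0.
rewrite padic_val_int absz_nat lognM ?expn_gt0 ?abc0 // lognX.
have [p2|p_odd] := eqVneq p 2%N.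
  have abE : logn 2 (al * be) = 0%N.
    by rewrite logn_coprime // coprime2n oddM oal obe.
  have abcE : logn 2 (al * be * (al + be)) = logn 2 (al + be).
    by rewrite lognM ?abE ?muln_gt0 ?addn_gt0 ?odd_gt0.
  left; have := le3 p2; rewrite {}p2 abcE (_ : logn 2 16 = 4)%N //.
  by move: (logn 2 _) => v; lia.
have p16 : ~~ (p %| 16)%N.
  by rewrite -[16%N]/(2 ^ 4)%N Euclid_dvdX // dvdn_prime2 // (negbTE p_odd).
have log16 : logn p 16 = 0%N by rewrite lognE p_prime (negbTE p16) andbF.
rewrite log16.
have [p_abc|/negbTE pn] := boolP (p %| al * be * (al + be))%N; last first.
  by left; rewrite lognE pn !andbF.
have c4E : c4 E = (16 * (al ^ 2 + al * be + be ^ 2))%N%:Z%:~R.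
  rewrite /E /c4 /b2 /b4 /= -pmulrn !(natrM, natrD, natrX); ring.
have c4p := frey_c4_coprime p_prime p_abc.
right; rewrite c4E padic_val_int absz_nat intr_eq0 eqz_nat.
have c40 : (0 < al ^ 2 + al * be + be ^ 2)%N by rewrite !addn_gt0 expn_gt0 odd_gt0.
rewrite -lt0n muln_gt0 c40 lognM // log16 logn_coprime //.
by rewrite prime_coprime.
Qed.

Lemma reduced_model_minimal (k m : nat) : (al + (al + be) = 1 + 4 * k)%N ->
  (al + be = 16 * m)%N ->
  (`|discriminant (reduced_model k m)| * 256 = (al * be * (al + be)) ^ 2)%N /\
  global_minimal_model E (reduced_model k m).
Proof.
move=> ek em; have iso := isomorphic_reduced ek em.
have ekZ : 1 + 4 * k%:Z = al%:Z + (al%:Z + be%:Z) by rewrite -!PoszD ek.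
have emZ : al%:Z + be%:Z = 16 * m%:Z by rewrite -!PoszD em.
have b2E : (1 ^+ 2 + 4 * k%:Z : int) = al%:Z + 16 * m%:Z by rewrite -emZ -ekZ expr1n.
have disc : discriminant (reduced_model k m) = ((al * be * m) ^ 2)%N%:Z.
  rewrite /discriminant /b8 /b6 /b4 /b2 /= b2E.
  rewrite -[RHS]/((al%:Z * be%:Z * m%:Z) ^+ 2).
  have -> : be%:Z = 16 * m%:Z - al%:Z by rewrite -emZ addrC addKr.
  ring.
have sq : (`|discriminant (reduced_model k m)| * 256 = (al * be * (al + be)) ^ 2)%N.
  by rewrite disc absz_nat em -[256%N]/(16 ^ 2)%N -expnMn; congr (_ ^ 2)%N; lia.
split=> // p p_prime.
apply: (minimal_model_criterion p_prime iso).
- exact: padic_integral_int.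
- exact: frey_discriminant_neq0.
rewrite discriminant_intr c4_intr !padic_val_int.
have [p_abc|pn] := boolP (p %| al * be * (al + be))%N; last first.
  left; suff -> : logn p `|discriminant (reduced_model k m)| = 0%N by [].
  rewrite lognE p_prime /= (_ : (p %| _)%N = false) ?andbF //.
  apply: contraNF pn => pd; have := dvdn_mulr 256 pd; rewrite sq.
  by rewrite Euclid_dvdX // andbT.
have c4E : c4 (reduced_model k m) = (al ^ 2 + al * be + be ^ 2)%N%:Z.
  rewrite /c4 /b2 /b4 /= b2E.
  transitivity ((al%:Z + 16 * m%:Z) ^+ 2 - 3 * al%:Z * (16 * m%:Z)); first ring.
  rewrite -emZ -[RHS]/(al%:Z ^+ 2 + al%:Z * be%:Z + be%:Z ^+ 2); ring.
right; rewrite c4E intr_eq0 eqz_nat absz_nat.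
have c40 : (0 < al ^ 2 + al * be + be ^ 2)%N by rewrite !addn_gt0 expn_gt0 odd_gt0.
rewrite -lt0n c40 logn_coprime // prime_coprime //.
exact: frey_c4_coprime.
Qed.

End FreyModels.

(** * Reduction types and conductor *)

Lemma bad_reduction (E : weierstrass rat) p (W : weierstrass int) : prime p ->
  minimal_model_at p E (map_weierstrass intr W) -> discriminant W != 0 ->
  (p %| `|discriminant W|)%N -> ~ good_reduction p E.
Proof.
move=> p_prime minW d0 pd [W' minW' v0].
have := minimal_model_val minW minW'; rewrite v0 discriminant_intr padic_val_int.
move=> -[] /eqP; rewrite -leqn0 leqNgt logn_gt0 mem_primes p_prime pd absz_gt0.
by rewrite d0.
Qed.

Section FreyReduction.
Variables al be : nat.
Hypotheses (co : coprime al be) (oal : odd al) (obe : odd be).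
Let E := frey_equation al%:R be%:R.

Lemma short_model_discriminant :
  discriminant (short_model al be) = (16 * (al * be * (al + be)) ^ 2)%N%:Z.
Proof.
apply/eqP; rewrite -(eqr_int rat) -discriminant_intr map_short_model.
by rewrite frey_discriminant // -pmulrn [in X in _ == X]natrM natrX.
Qed.

(** Modulo p two of the roots 0, al, - be of the cubic coincide and the third one
    is different.  The double root gives the node; it is 0 when p divides al or
    be, and al when p divides al + be. *)
Lemma frey_multiplicative p : prime p -> p != 2%N ->
  (p %| al * be * (al + be))%N -> has_node (map_weierstrass (ratr : rat -> 'F_p) E).
Proof.
move=> p_prime p2 p_abc.
have charP (n : nat) : (n%:R == 0 :> 'F_p) = (p %| n)%N.
  by rewrite (dvdn_pcharf (pchar_Fp p_prime)).
have -> : map_weierstrass (ratr : rat -> 'F_p) E =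
    Weierstrass 0 (be%:R - al%:R) 0 (- (al%:R * be%:R)) 0.
  rewrite /E -map_short_model /map_weierstrass /= !ratr_int.
  by rewrite !(rmorphB, rmorphN, rmorphM) /= rmorph0.
have four0 : (4 : 'F_p) != 0.
  by rewrite charP -[4%N]/(2 ^ 2)%N Euclid_dvdX // dvdn_prime2 // (negbTE p2).
have p1 : ~~ ((p %| al) && (p %| be))%N.
  rewrite -dvdn_gcd (eqP co) dvdn1 neq_ltn prime_gt1 //.
  by rewrite orbT.
move: p1 p_abc; rewrite !Euclid_dvdM // -!charP natrD.
move: (al%:R : 'F_p) (be%:R : 'F_p) => a b p1.
have [a0|a0] := eqVneq a 0.
  move=> _; exists 0, 0; rewrite a0 eqxx /= in p1 *; split.
    by split; rewrite /on_curve /=; ring.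
  by rewrite (_ : _ + _ = 4 * b) ?mulf_neq0 //=; ring.
have [b0|b0] := eqVneq b 0.
  move=> _; exists 0, 0; rewrite b0 /=; split.
    by split; rewrite /on_curve /=; ring.
  by rewrite (_ : _ + _ = - (4 * a)) ?oppr_eq0 ?mulf_neq0 //=; ring.
rewrite /= addr_eq0 => /eqP aE; exists a, 0.
have bE : b = - a by rewrite aE opprK.
rewrite bE /=; split.
  by split; rewrite /on_curve /=; ring.
by rewrite (_ : _ + _ = 4 * a) ?mulf_neq0 //=; ring.
Qed.

Lemma frey_odd_exponent p : prime p -> p != 2%N ->
  (p %| al * be * (al + be))%N -> conductor_exponent E p = 1%N.
Proof.
move=> p_prime p2 p_abc.
have minE : minimal_model_at p E E.
  by apply: short_model_minimal => // p2'; rewrite p2' in p2.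
have mult : multiplicative_reduction p E by exists E => //; apply: frey_multiplicative.
have bad : ~ good_reduction p E.
  have discE := short_model_discriminant.
  apply: (@bad_reduction _ p (short_model al be)) => //.
  - by rewrite map_short_model.
  - by rewrite discE eqz_nat -lt0n muln_gt0 /= expn_gt0 !muln_gt0 addn_gt0 !odd_gt0.
  by rewrite discE absz_nat dvdn_mull // Euclid_dvdX // p_abc.
rewrite /conductor_exponent; case: asboolP => // _; by case: asboolP.
Qed.

End FreyReduction.

(** The power of 2 is 2^4 for the Frey equation itself and 2^(4 - 12) after the
    reduction at 2. *)
Lemma frey_minimal_model T : parity_class T ->
  exists W, global_minimal_model (frey T) W /\
    if (logn 2 (tc T) <= 3)%N then `|discriminant W|%N = (16 * abc T ^ 2)%N
    else (`|discriminant W| * 256)%N = (abc T ^ 2)%N.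
Proof.
move=> /frey_orientation[al [be [-> -> -> [co oal obe al1]]]].
case: leqP => [le3|gt3].
  exists (short_model al be); split=> [p p_prime|].
    by rewrite map_short_model; apply: short_model_minimal => // ->.
  by rewrite short_model_discriminant absz_nat.
have d16 : (2 ^ 4 %| al + be)%N.
  by apply: dvdn_trans (pfactor_dvdnn 2 _); apply: dvdn_exp2l.
have {}al1 : (al %% 4 = 1)%N by apply: al1; apply: dvdn_trans d16.
have [m em] : exists m, (al + be = 16 * m)%N.
  by exists ((al + be) %/ 16)%N; rewrite mulnC divnK.
have [k ek] : exists k, (al + (al + be) = 1 + 4 * k)%N.
  by exists (al %/ 4 + 4 * m)%N; lia.
exists (reduced_model al k m).
by have [] := reduced_model_minimal co oal obe ek em.
Qed.

Definition odd_radical (n : nat) : nat := (\prod_(p <- primes n | p != 2%N) p)%N.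

Lemma prod_two_out (r : seq nat) (F : nat -> nat) : uniq r ->
  (\prod_(p <- r) F p =
   (if 2%N \in r then F 2%N else 1) * \prod_(p <- r | p != 2%N) F p)%N.
Proof.
move=> r_uniq; case: ifP => [r2|r2]; first by rewrite (bigD1_seq 2%N).
rewrite mul1n [LHS]big_seq [RHS]big_seq_cond; apply: eq_bigl => p.
by have [->|//] := eqVneq p 2%N; rewrite ?r2 ?andbT.
Qed.

Lemma odd_radical_odd n : odd (odd_radical n).
Proof.
rewrite /odd_radical big_seq_cond; elim/big_ind: _ => // [x y ox oy|p /andP[pn p2]].
  by rewrite oddM ox.
have p_prime : prime p by move: pn; rewrite mem_primes => /andP[].
by case: (even_prime p_prime) p2 => [->|].
Qed.

Lemma dvdn_odd_radical p n : p != 2%N -> p \in primes n -> (p %| odd_radical n)%N.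
Proof.
move=> p2 pn; rewrite /odd_radical -big_filter (bigD1_seq p) /= ?dvdn_mulr //.
  by rewrite mem_filter p2.
by rewrite filter_uniq ?primes_uniq.
Qed.

Lemma conductor_exponent2_le :
  exists K, forall E, (conductor_exponent E 2 <= K)%N.
Proof.
have [K wildK] := wild_exponent2_bounded; exists (2 + K)%N => E.
rewrite /conductor_exponent; case: ifP => // _; case: ifP => // _.
by rewrite leq_add2l.
Qed.

(** The primes dividing the minimal discriminant are those dividing abc, except
    that 2 is missing when v_2(c) = 4.  The conductor exceeds 1 because the
    reduction at 2 is bad when v_2(c) <= 3, and because ab > 1 has an odd prime
    factor otherwise. *)
Lemma frey_conductor T : parity_class T ->
  let E := frey T in
  let f := logn 2 (conductor E) in
  [/\ conductor E = (2 ^ f * odd_radical (abc T))%N,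
      radical (abc T) = (2 * odd_radical (abc T))%N,
      (f <= conductor_exponent E 2)%N & (1 < conductor E)%N].
Proof.
move=> parT E.
have [W [minW discW]] := frey_minimal_model parT.
have [al [be [EE abcE tcE [co oal obe al1]]]] := frey_orientation parT.
have abc0 : (0 < abc T)%N by rewrite abcE !muln_gt0 addn_gt0 !odd_gt0.
have dE : discriminant E != 0 by rewrite /E EE frey_discriminant_neq0.
have d0 := global_minimal_disc_neq0 dE minW.
have absE := minimal_discriminant_abs dE minW.
set M := odd_radical (abc T); have oM : odd M := odd_radical_odd _.
have M0 : (0 < M)%N by rewrite odd_gt0.
have abc2 : 2%N \in primes (abc T).
  by rewrite mem_primes abc0 abcE dvdn_mull // dvdn2 oddD oal obe.
have radE : radical (abc T) = (2 * M)%N.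
  by rewrite /radical prod_two_out ?primes_uniq // abc2.
set r := primes `|minimal_discriminant E|.
have r_abc p : p != 2%N -> (p \in r) = (p \in primes (abc T)).
  move=> p2; rewrite /r absE !mem_primes absz_gt0 d0 abc0 /=.
  have [p_prime|//] := boolP (prime p).
  have p_2X n : (p %| 2 ^ n)%N = false.
    by apply/negbTE; rewrite Euclid_dvdX // dvdn_prime2 // (negbTE p2).
  move: discW; case: ifP => _ discW; rewrite /=.
    by rewrite discW Euclid_dvdM // (p_2X 4) Euclid_dvdX // andbT.
  have <- : (p %| abc T ^ 2)%N = (p %| abc T)%N by rewrite Euclid_dvdX // andbT.
  by rewrite -discW Euclid_dvdM // (p_2X 8) orbF.
have oddE : (\prod_(p <- r | p != 2%N) p ^ conductor_exponent E p = M)%N.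
  rewrite -[LHS]big_filter /M /odd_radical -[RHS]big_filter.
  rewrite (perm_big [seq p <- primes (abc T) | p != 2%N]); last first.
    apply: uniq_perm; rewrite ?filter_uniq ?primes_uniq // => p.
    by rewrite !mem_filter; have [//|p2] := eqVneq p 2%N; rewrite /= r_abc.
  rewrite big_seq [RHS]big_seq; apply: eq_bigr => p.
  rewrite mem_filter mem_primes => /andP[p2 /and3P[p_prime _ p_abc]].
  rewrite /E EE frey_odd_exponent ?expn1 //.
  by rewrite -abcE.
have condE : conductor E =
    (2 ^ (if 2%N \in r then conductor_exponent E 2 else 0) * M)%N.
  by rewrite /conductor -/r prod_two_out ?primes_uniq // oddE; case: ifP.
have fE : logn 2 (conductor E) = (if 2%N \in r then conductor_exponent E 2 else 0)%N.
  rewrite condE lognM ?expn_gt0 // pfactorK // logn_coprime ?addn0 //.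
  by rewrite coprime2n.
rewrite fE; split=> //; first by case: ifP.
rewrite condE; move: discW; case: ifP => le3 discW.
  have d2 : (2 %| `|discriminant W|)%N by rewrite discW dvdn_mulr.
  have -> : 2%N \in r by rewrite /r absE mem_primes absz_gt0 d0.
  apply: leq_trans (leq_pmulr _ M0); rewrite -{1}(expn0 2) ltn_exp2l //.
  have bad := bad_reduction (p := 2) isT (minW 2%N isT) d0 d2.
  rewrite /conductor_exponent; case: asboolP => // _; by case: asboolP.
apply: leq_trans (leq_pmull _ _); last by rewrite expn_gt0.
have ab1 : (1 < al * be)%N.
  have tc8 : (2 ^ 3 < tc T)%N.
    rewrite ltnNge; apply: contraFN le3 => tc8.
    rewrite -ltnS -(ltn_exp2l _ _ (isT : 1 < 2)%N) -[(2 ^ 4)%N]/16%N.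
    apply: leq_ltn_trans (dvdn_leq _ (pfactor_dvdnn 2 _)) (leq_ltn_trans tc8 _) => //.
    by rewrite tcE addn_gt0 odd_gt0.
  move: tc8 (odd_gt0 oal) (odd_gt0 obe); rewrite tcE; clear; nia.
have q_prime := pdiv_prime ab1.
have q_ab := pdiv_dvd (al * be).
have q2 : pdiv (al * be) != 2%N.
  by apply: contraTneq q_ab => ->; rewrite dvdn2 oddM oal obe.
apply: leq_trans (prime_gt1 q_prime) (dvdn_leq M0 (dvdn_odd_radical q2 _)).
by rewrite mem_primes q_prime abc0 abcE dvdn_mulr.
Qed.

(** * Logarithms and the Szpiro quotient *)

Section Logarithms.
Variable R : realType.
Local Notation lnn n := (ln n%:R : R).

Lemma ln_natM m n : (0 < m)%N -> (0 < n)%N -> lnn (m * n) = lnn m + lnn n.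
Proof. by move=> m0 n0; rewrite natrM lnM // posrE ltr0n. Qed.

Lemma ln_natX m n : (0 < m)%N -> lnn (m ^ n) = lnn m *+ n.
Proof. by move=> m0; rewrite natrX lnXn // ltr0n. Qed.

Lemma ler_ln_nat m n : (0 < m)%N -> (m <= n)%N -> lnn m <= lnn n.
Proof.
move=> m0 mn; rewrite ler_ln ?ler_nat // posrE ltr0n //.
exact: leq_trans mn.
Qed.

Lemma ln2_gt0 : 0 < ln 2 :> R.
Proof. by rewrite ln_gt0 // ltr1n. Qed.

Variable T : triple.
Hypothesis parT : parity_class T.
Let logR : R := lnn (radical (abc T)).
Let log_ab : R := lnn (ta T * tb T).
Let f2 : R := (logn 2 (conductor (frey T)))%:R.

Lemma triple_gt0 : [/\ (0 < ta T)%N, (0 < tb T)%N, (0 < tc T)%N & (0 < abc T)%N].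
Proof. by case: parT => [[a0 b0 c0] _ _ _]; split; rewrite // /abc !muln_gt0 a0 b0. Qed.

Lemma radical_gt0 n : (0 < radical n)%N.
Proof.
rewrite /radical big_seq; apply: prodn_cond_gt0 => p.
by rewrite mem_primes => /andP[/prime_gt0].
Qed.

Lemma ln_abc : lnn (abc T) = log_ab + lnn (tc T).
Proof. by have [a0 b0 c0 _] := triple_gt0; rewrite /abc ln_natM // muln_gt0 a0. Qed.

Lemma total_defectE : total_defect R T = log_ab + lnn (tc T) - logR.
Proof.
have [_ _ _ abc0] := triple_gt0.
by rewrite /total_defect ln_div ?ln_abc // posrE ltr0n ?radical_gt0.
Qed.

Lemma ln_minimal_discriminant :
  ln (`|minimal_discriminant (frey T)|%N%:R)
    = 2 * total_defect R T + 2 * logR + (kappa2 T)%:~R * ln 2.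
Proof.
have [_ _ _ abc0] := triple_gt0.
have [W [minW discW]] := frey_minimal_model parT.
have [al [be [EE _ _ [co oal obe _]]]] := frey_orientation parT.
have dE : discriminant (frey T) != 0 by rewrite EE frey_discriminant_neq0.
have d0 := global_minimal_disc_neq0 dE minW.
rewrite (minimal_discriminant_abs dE minW) total_defectE.
have -> : forall x : R, 2 * (log_ab + lnn (tc T) - logR) + 2 * logR + x
    = lnn (abc T) *+ 2 + x by move=> x; rewrite ln_abc; ring.
rewrite -ln_natX // /kappa2; move: discW; case: ifP => _ discW.
  rewrite discW -[16%N]/(2 ^ 4)%N ln_natM ?expn_gt0 ?abc0 //.
  by rewrite (ln_natX 4) // -pmulrn mulr_natl addrC.
rewrite -discW -[256%N]/(2 ^ 8)%N ln_natM ?absz_gt0 // (ln_natX 8) //.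
by rewrite mulrNz mulNr -pmulrn mulr_natl addrK.
Qed.

Lemma ln_conductor : ln (conductor (frey T))%:R = logR + (f2 - 1) * ln 2.
Proof.
have [cE rE _ _] := frey_conductor parT.
have M0 : (0 < odd_radical (abc T))%N by rewrite odd_gt0 ?odd_radical_odd.
rewrite {1}cE /logR rE !ln_natM ?expn_gt0 // ln_natX // -mulr_natl -/f2; ring.
Qed.

Lemma ln_conductor_gt0 : 0 < logR + (f2 - 1) * ln 2.
Proof.
by rewrite -ln_conductor; have [_ _ _ N1] := frey_conductor parT; rewrite ln_gt0 // ltr1n.
Qed.

Lemma szpiroE : szpiro R (frey T)
  = (2 * total_defect R T + 2 * logR + (kappa2 T)%:~R * ln 2)
    / (logR + (f2 - 1) * ln 2).
Proof. by rewrite /szpiro ln_minimal_discriminant ln_conductor. Qed.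

Lemma defect_ge (eps : R) : 0 <= radical_excess eps T ->
  log_ab + eps * logR <= total_defect R T.
Proof. by rewrite total_defectE /radical_excess -/logR; lra. Qed.

Lemma ln_ab_ge : lnn (tc T) - ln 2 <= log_ab.
Proof.
have [a0 b0 c0 _] := triple_gt0; rewrite lerBlDl -ln_natM ?muln_gt0 ?a0 //.
apply: ler_ln_nat => //; case: parT => _ _ <- _; nia.
Qed.

(** The numerator is at least 4 (1 + eps) log R - 10 log 2, where 10 log 2 comes
    from ab >= c / 2 and kappa_2 >= - 8.  After subtracting 2 (1 + eps) times the
    denominator, 2 (1 + eps) (log R - (f_2 - 1) log 2) - 10 log 2 is left, which is
    positive because f_2 <= K and log R >= (K + 10) log 2. *)
Lemma szpiro_ge_large (eps : R) (K : nat) : 0 < eps ->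
  0 <= radical_excess eps T -> (conductor_exponent (frey T) 2 <= K)%N ->
  (2 ^ (K + 10) <= radical (abc T))%N ->
  2 + 2 * eps <= szpiro R (frey T).
Proof.
move=> eps0 exc fK radK; rewrite szpiroE ler_pdivlMr ?ln_conductor_gt0 //.
have f2K : f2 <= K%:R.
  by have [_ _ le_f _] := frey_conductor parT; rewrite ler_nat (leq_trans le_f).
have logRK : (K%:R + 10) * ln 2 <= logR.
  have := ler_ln_nat _ radK; rewrite expn_gt0 => /(_ isT).
  by rewrite ln_natX // -[ln _ *+ _]mulr_natl natrD.
have kappa_ge : - 8 <= (kappa2 T)%:~R :> R.
  have -> : - 8 = (- 8%:Z)%:~R :> R by rewrite mulrNz -pmulrn.
  by rewrite ler_int /kappa2; case: ifP.
have l20 := ln2_gt0.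
have exc' : (1 + eps) * logR <= lnn (tc T) by move: exc; rewrite /radical_excess subr_ge0.
have ab := ln_ab_ge; rewrite total_defectE.
move: (lnn (tc T)) log_ab logR f2 (ln 2) ((kappa2 T)%:~R : R) (K%:R : R)
   ab exc' l20 kappa_ge logRK f2K => c ab L f l k K' *.
have h1 : f * l <= K' * l by rewrite ler_pM2r.
have h2 : - 8 * l <= k * l by rewrite ler_pM2r.
have h3 : (1 + eps) * (10 * l) <= (1 + eps) * (L - f * l) by rewrite ler_pM2l; lra.
have h4 : l <= (1 + eps) * l by rewrite ler_peMl; lra.
lra.
Qed.

End Logarithms.

Theorem corollary8p5 (R : realType) :
  (forall T : triple, parity_class T ->
    let E := frey T in
    let logR : R := ln (radical (abc T))%:R in
    let f2 : R := (logn 2 (conductor E))%:R in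
    let log2 : R := ln 2 in
    let kappa : R := (kappa2 T)%:~R in
    let delta : R := total_defect R T in
    let log_ab : R := ln (ta T * tb T)%:R in
    [/\ ln (`|minimal_discriminant E|%N%:R)
          = 2 * delta + 2 * logR + kappa * log2,
        (1 < conductor E)%N /\
        ln (conductor E)%:R = logR + (f2 - 1) * log2,
        szpiro R E
          = (2 * delta + 2 * logR + kappa * log2) / (logR + (f2 - 1) * log2) &
        forall eps : R, 0 < eps -> 0 <= radical_excess eps T ->
          delta >= log_ab + eps * logR /\
          szpiro R E >=
            (2 * (1 + eps) * logR + 2 * log_ab + kappa * log2)
            / (logR + (f2 - 1) * log2)]) /\
  (exists (C : R) (R0 : nat),
    forall (eps : R) (T : nat -> triple),
      0 < eps ->
      injective T ->
      (forall n, parity_class (T n) /\ 0 <= radical_excess eps (T n)) ->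
      (forall B : nat, exists n0 : nat, forall n, (n0 <= n)%N ->
         (B <= radical (abc (T n)))%N) ->
      forall n, (R0 <= radical (abc (T n)))%N ->
        szpiro R (frey (T n)) >=
          2 + 2 * eps - C / ln (radical (abc (T n)))%:R).
Proof.
split=> [T parT E logR f2 log2 kappa delta log_ab|].
  split; first exact: ln_minimal_discriminant.
  - by split; [have [] := frey_conductor parT | exact: ln_conductor].
  - exact: szpiroE.
  move=> eps _ exc; have defect := defect_ge parT exc; split=> //.
  rewrite szpiroE // ler_pM2r ?invr_gt0 ?ln_conductor_gt0 //.
  by move: defect; rewrite -/delta -/logR -/log_ab -/kappa -/log2; lra.
have [K fK] := conductor_exponent2_le; exists 0, (2 ^ (K + 10))%N.
move=> eps T eps0 _ hT _ n radK; have [parT exc] := hT n.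
rewrite mul0r subr0; exact: (szpiro_ge_large parT eps0 exc (fK _) radK).
Qed.
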